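(* For each of the following finite groups $G$, let $n=|G|$, $m=|Z(G)|$, let $C_G(x_1),\dots,C_G(x_t)$ be all the distinct centralizers of noncentral elements of $G$ and let $m_i=|C_G(x_i)\setminus Z(G)|$. Then the following hold. (i) For $G=D_{2k}$ with $k\ge 3$ odd: $n=2k$, $m=1$, $t=k+1$, the $m_i$ are $k-1$ (once) and $1$ ($k$ times), and $\kappa(G)=k^{k-2}$. (ii) For $G=D_{2k}$ with $k\ge 4$ even: $n=2k$, $m=2$, $t=\frac{k}{2}+1$, the $m_i$ are $k-2$ (once) and $2$ ($\frac{k}{2}$ times), and $\kappa(G)=2^{\frac{3k+2}{2}}k^{k-2}$. (iii) For $G=Q_{4k}$ with $k\ge 2$: $n=4k$, $m=2$, $t=k+1$, the $m_i$ are $2k-2$ (once) and $2$ ($k$ times), and $\kappa(G)=2^{5k-1}k^{2k-2}$. (iv) For $G=SD_{2^k}$ with $k\ge 4$: $n=2^k$, $m=2$, $t=2^{k-2}+1$, the $m_i$ are $2^{k-1}-2$ (once) and $2$ ($2^{k-2}$ times), and $\kappa(G)=2^{(2^{k-2}-1)(2k+1)+4}$. (v) For $G=P$ a nonabelian group of order $p^3$, $p$ a prime: $n=p^3$, $m=p$, $t=p+1$, all $m_i$ equal $p^2-p$, and $\kappa(G)=p^{2p^3-5}$.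
   Context: $D_{2k}=\langle x,y\mid x^k=y^2=1,\ yxy^{-1}=x^{-1}\rangle$ is the dihedral group of order $2k$; $SD_{2^k}=\langle x,y\mid x^{2^{k-1}}=y^2=1,\ yxy^{-1}=x^{-1+2^{k-2}}\rangle$ is the semidihedral group; $Q_{4k}=\langle x,y\mid x^{2k}=1,\ y^2=x^k,\ yxy^{-1}=x^{-1}\rangle$ is the generalized quaternion group. $Z(G)$ is the center of $G$ and $C_G(x)$ the centralizer of $x$ in $G$. For a finite group $G$, the commuting graph $\mathcal{C}(G)$ is the simple graph with vertex set $G$ in which two distinct elements are adjacent if and only if they commute. $\kappa(G)$ denotes the number of spanning trees of $\mathcal{C}(G)$. *)

(* Defs.v *)
From mathcomp Require Import all_boot all_fingroup all_solvable.
Set Implicit Arguments.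
Unset Strict Implicit.
Unset Printing Implicit Defensive.

Local Open Scope group_scope.

Structure sgraph := SGraph {
  vertex :> finType;
  adj : rel vertex;
  adj_sym : symmetric adj;
  adj_irr : irreflexive adj }.

Section Trees.

Variable V : finType.

(* An edge is a two-element set of vertices. *)
Definition edge_rel (F : {set {set V}}) : rel V :=
  fun x y => (x != y) && ([set x; y] \in F).

Definition connectedb (e : rel V) : bool := [forall x, forall y, connect e x y].

(* No cycle with at least three distinct vertices.  Only lengths up to #|V| can
   occur, so bounding n loses nothing (see acyclicP) and keeps this boolean. *)
Definition acyclic (e : rel V) : bool :=
  [forall n : 'I_#|V|.+1, forall p : n.-tuple V, ~~ ((2 < n)%N && ucycleb e p)].

Lemma acyclicP (e : rel V) :
  reflect (forall p : seq V, (2 < size p)%N -> ~ ucycle e p) (acyclic e).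
Proof.
apply: (iffP forallP) => [acy p p_gt2 p_cyc | acy n].
  have lt_pV : (size p < #|V|.+1)%N.
    by case/andP: p_cyc => _ /card_uniqP <-; rewrite ltnS max_card.
  have /forallP/(_ (in_tuple p)) := acy (Ordinal lt_pV).
  by rewrite /= p_gt2; case/negP.
apply/forallP=> p; apply/negP=> /andP[n_gt2 p_cyc].
by apply: (acy p); rewrite ?size_tuple.
Qed.

End Trees.

Definition edges (g : sgraph) : {set {set g}} :=
  [set E | [exists x, exists y, adj x y && (E == [set x; y])]].

(* A spanning tree contains all the vertices, so it is given by its edges. *)
Definition spanning_tree (g : sgraph) (F : {set {set g}}) : bool :=
  [&& F \subset edges g, connectedb (edge_rel F) & acyclic (edge_rel F)].

Definition num_spanning_trees (g : sgraph) : nat :=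
  #|[set F : {set {set g}} | spanning_tree F]|.

Section CommutingGraph.

Variables (gT : finGroupType) (G : {group gT}).

Definition commuting : rel (subg_of G) :=
  fun x y => (x != y) && (x * y == y * x).

Lemma commuting_sym : symmetric commuting.
Proof. by move=> x y; rewrite /commuting eq_sym [x * y == _]eq_sym. Qed.

Lemma commuting_irr : irreflexive commuting.
Proof. by move=> x; rewrite /commuting eqxx. Qed.

Definition commuting_graph : sgraph := SGraph commuting_sym commuting_irr.

Definition kappa : nat := num_spanning_trees commuting_graph.

Definition noncentral_centralizers : {set {set gT}} :=
  [set 'C_G[x] | x in G :\: 'Z(G)].

(* The m_i, listed with multiplicity, one for each distinct centralizer. *)
Definition centralizer_sizes : seq nat :=
  [seq #|C :\: 'Z(G)| | C : {set gT} <- enum noncentral_centralizers].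

End CommutingGraph.

(* G is a finite group isomorphic to the one given by the presentation.  The
   library's \isog Grp means isomorphic to the largest finite quotient of the
   presented group, which is that group itself as all three are finite. *)
Definition is_dihedral (gT : finGroupType) (G : {group gT}) (k : nat) : Prop :=
  G \isog Grp (x : y : x ^+ k = y ^+ 2 = 1, y * x * y^-1 = x^-1).

Definition is_semidihedral (gT : finGroupType) (G : {group gT}) (k : nat) :
    Prop :=
  G \isog Grp (x : y : x ^+ (2 ^ (k - 1))%N = y ^+ 2 = 1,
                       y * x * y^-1 = x^-1 * x ^+ (2 ^ (k - 2))%N).

Definition is_quaternion (gT : finGroupType) (G : {group gT}) (k : nat) : Prop :=
  G \isog Grp (x : y : x ^+ (2 * k)%N = 1, y ^+ 2 = x ^+ k,
                       y * x * y^-1 = x^-1).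

(* Main.v *)
From HB Require Import structures.
Require Import Defs.
From mathcomp Require Import all_boot all_order all_algebra all_fingroup all_solvable.
From mathcomp Require Import zify ring.
Set Implicit Arguments.
Unset Strict Implicit.
Unset Printing Implicit Defensive.

(** Orienting a spanning tree towards a fixed root turns it into a parent map on
    the vertices, so expanding the determinant of the reduced Laplacian along all
    of its rows at once counts spanning trees.  In each of the groups the
    centralizers of noncentral elements are abelian, so the sets
    [C_G(x) \ Z(G)] partition the noncentral elements and the commuting graph is
    the join of the complete graph on [Z(G)] with disjoint complete graphs on
    those sets.  The reduced Laplacian of such a join is a diagonal matrix minus
    a matrix of rank at most [t + 1], and Sylvester's identity
    [det (1 - A B) = det (1 - B A)] reduces its determinant to that of an arrow
    matrix, giving
      [kappa = n ^ (m - 1) * m ^ (t - 1) * \prod_i (m + m_i) ^ (m_i - 1)].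
    The dihedral, semidihedral and quaternion groups all have an abelian subgroup
    [H] of index 2; then [C_G(x)] is [H] for noncentral [x] in [H] and has order
    [2 m] for [x] outside [H], so only [|H|] and [|Z(G)|] matter. *)

Local Open Scope group_scope.
Local Open Scope nat_scope.

(** * Spanning trees and parent maps *)

Section ParentMaps.

Variables (V : finType) (r : V).
Implicit Types (e : rel V) (f : {ffun V -> V}) (F : {set {set V}}).

(** A spanning tree oriented towards [r]: [f] sends a vertex to its parent and fixes the root, and
    the last clause excludes any other cycle. *)
Definition parent_map e f : bool :=
  [&& f r == r, [forall (i | i != r), e i (f i)]
    & [forall i, fconnect f i r]].

Definition parent_edges f : {set {set V}} := [set [set i; f i] | i in [set~ r]].

Lemma set2_eq (a b c d : V) :
  [set a; b] = [set c; d] -> (a = c /\ b = d) \/ (a = d /\ b = c).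
Proof.
move=> eqE; have := set21 a b; have := set22 a b; rewrite eqE !inE.
have := set21 c d; have := set22 c d; rewrite -eqE !inE.
do 4![case/orP=> /eqP ?]; subst; by [left | right].
Qed.

Lemma parent_edgesP f (i j : V) :
  reflect ((i != r /\ j = f i) \/ (j != r /\ i = f j))
          ([set i; j] \in parent_edges f).
Proof.
apply: (iffP imsetP) => [[k] | [[ri ->] | [rj ->]]].
- by rewrite !inE => rk /set2_eq[[-> ->]|[-> ->]]; [left | right].
- by exists i; rewrite ?inE.
by exists j; rewrite ?inE // setUC.
Qed.

(** The ranking is the distance to [r], which the first step of a shortest path decreases. *)
Lemma root_ranking e :
    (forall i, connect e i r) ->
  exists h : V -> nat, forall i, i != r -> exists2 j, e i j & (h j < h i)%N.
Proof.
move=> conn.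
have lenP i : exists n, [exists p : n.-tuple V, path e i p && (last i p == r)].
  have /connectP[p ep lp] := conn i.
  by exists (size p); apply/existsP; exists (in_tuple p); rewrite ep -lp eqxx.
exists (fun i => ex_minn (lenP i)) => i ri.
case: ex_minnP => n /existsP[[p /= /eqP <-]].
case: p => [|j p] /=; first by rewrite (negPf ri).
case/andP=> /andP[eij ep] lp _; exists j => //.
case: ex_minnP => k _ kmin; rewrite ltnS; apply: kmin.
by apply/existsP; exists (in_tuple p); rewrite ep lp.
Qed.

Lemma parent_map_ranking e f :
    parent_map e f ->
  exists h : V -> nat, forall i, i != r -> (h (f i) < h i)%N.
Proof.
case/and3P=> _ _ /forallP /root_ranking[h hP]; exists h => i ri.
by have [j /eqP->] := hP i ri.
Qed.

Lemma fconnect_root f (h : V -> nat) :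
  (forall i, i != r -> (h (f i) < h i)%N) -> forall i, fconnect f i r.
Proof.
move=> hP i; have [n] := ubnP (h i).
elim: n i => // n IHn i lt_hn; have [-> // | ri] := eqVneq i r.
by apply: connect_trans (fconnect1 f i) (IHn _ (leq_trans (hP i ri) lt_hn)).
Qed.

(** By induction on the rank for [f]: if the edge [{i, f i}] came from [g] at [f i], then
    [i = g (f i) = f (f i)] by induction, against the decrease of the rank along [f]. *)
Lemma parent_edges_inj e : {in parent_map e &, injective parent_edges}.
Proof.
move=> f g fP gP eqFG; have [h hP] := parent_map_ranking fP.
have [fr _ _] := and3P fP; have [gr _ _] := and3P gP.
apply/ffunP=> i; have [n] := ubnP (h i).
elim: n i => // n IHn i lt_hn.
have [-> | ri] := eqVneq i r; first by rewrite (eqP fr) (eqP gr).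
have: [set i; f i] \in parent_edges g.
  by rewrite -eqFG; apply/parent_edgesP; left.
case/parent_edgesP => [[_ //] | [rfi gfi]].
have eq_fg := IHn _ (leq_trans (hP i ri) lt_hn).
by have := hP _ rfi; rewrite eq_fg -gfi ltnNge ltnW ?hP.
Qed.

Lemma edge_rel_sym F : symmetric (edge_rel F).
Proof. by move=> x y; rewrite /edge_rel eq_sym setUC. Qed.

Lemma parent_edges_connected e f :
  irreflexive e -> parent_map e f -> connectedb (edge_rel (parent_edges f)).
Proof.
move=> irr fP; have [h hP] := parent_map_ranking fP.
have [fr /forall_inP fe _] := and3P fP.
have to_r i : connect (edge_rel (parent_edges f)) i r.
  apply: connect_sub (fconnect_root hP i) => {i} i _ /eqP <-.
  have [-> | ri] := eqVneq i r; first by rewrite (eqP fr).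
  apply: connect1; rewrite /edge_rel; apply/andP; split; last first.
    by apply/parent_edgesP; left.
  by apply: contraTneq (fe i ri) => {1}->; rewrite irr.
apply/forallP=> i; apply/forallP=> j; apply: connect_trans (to_r i) _.
by rewrite (sym_connect_sym (@edge_rel_sym _)).
Qed.

(* A vertex of maximal rank on a cycle would have its parent as both of its
   neighbours on that cycle. *)
Lemma parent_edges_acyclic e f :
  parent_map e f -> acyclic (edge_rel (parent_edges f)).
Proof.
move=> fP; have [h hP] := parent_map_ranking fP.
apply/acyclicP=> p p_gt2 /andP[cyc_p uniq_p].
have [x0 x0p] : exists x, x \in p.
  by case: p p_gt2 {cyc_p uniq_p} => // x p; exists x; rewrite inE eqxx.
case: (arg_maxnP h x0p) => v vp vmax.
have toP w : w \in p -> edge_rel (parent_edges f) v w -> w = f v.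
  move=> wp /andP[_ /parent_edgesP[[_ ->] // | [rw fw]]].
  by have := vmax w wp; rewrite fw /= leqNgt hP.
case/rot_to: (vp) => i q rot_p.
have subp : {subset v :: q <= p} by move=> w; rewrite -rot_p mem_rot.
have := p_gt2; rewrite -(size_rot i) rot_p.
move: cyc_p uniq_p; rewrite -(rot_cycle i) -(rot_uniq i) rot_p.
case: q subp {rot_p} => [|a [|b q]] // subp /= /and3P[va _ cyc] uq _.
have /toP av : a \in p by apply: subp; rewrite !inE eqxx orbT.
have /toP lv : last b q \in p by apply: subp; rewrite inE in_cons mem_last !orbT.
move: cyc; rewrite rcons_path edge_rel_sym => /andP[_ /lv lfv].
case/and3P: uq => _ + _; rewrite -lfv in av.
by rewrite (av va) mem_last.
Qed.

(** Each vertex takes as parent a neighbour closer to the root. An edge of [F] missed by this choice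
    would close a cycle with a path of parent edges. *)
Lemma spanning_tree_parent_map e F :
    (forall x y, edge_rel F x y -> e x y) ->
    connectedb (edge_rel F) -> acyclic (edge_rel F) ->
    F \subset [set [set x.1; x.2] | x in [pred x : V * V | x.1 != x.2]] ->
  exists2 f, parent_map e f & F = parent_edges f.
Proof.
move=> Fe conn acyc F2.
have [|h hP] := @root_ranking (edge_rel F).
  by move=> i; apply: (forallP (forallP conn i)).
(* The default [i] is never reached, since a vertex other than [r] has a neighbour of smaller
   rank. *)
pose f := [ffun i => if i == r then r else
                     odflt i [pick j | edge_rel F i j && (h j < h i)%N]].
have fr : f r = r by rewrite ffunE eqxx.
have fP i : i != r -> edge_rel F i (f i) /\ (h (f i) < h i)%N.
  move=> ri; rewrite ffunE (negPf ri); case: pickP => /= [j /andP[] //|].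
  by have [j ej hj] := hP i ri => /(_ j); rewrite ej hj.
have f_root := @fconnect_root f h (fun i ri => proj2 (fP i ri)).
exists f.
  apply/and3P; split; first exact/eqP.
    by apply/forall_inP=> i /fP[/Fe].
  exact/forallP.
have sub : parent_edges f \subset F.
  apply/subsetP=> E /imsetP[i]; rewrite !inE => /fP[/andP[_ iF] _] ->; exact: iF.
apply/eqP; rewrite eqEsubset sub andbT; apply/subsetP=> E EF.
have /imsetP[[a b] /= ab defE] := subsetP F2 _ EF.
have {}ab : a != b := ab.
apply: contraT => EnF.
pose e' := edge_rel (parent_edges f).
have fe' : subrel (frel f) (connect e').
  move=> i _ /eqP <-; have [-> | ri] := eqVneq i r; first by rewrite fr.
  have [/andP[ni _] _] := fP i ri.
  by apply: connect1; rewrite /e' /edge_rel ni; apply/parent_edgesP; left.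
have /connectP[p0 /shortenP[p ep up _] lp] : connect e' a b.
  apply: connect_trans (connect_sub fe' (f_root a)) _.
  by rewrite (sym_connect_sym (@edge_rel_sym _)) (connect_sub fe' (f_root b)).
case/acyclicP/(_ (a :: p)): acyc.
  (* The path has at least two edges: an empty one means [a = b], and a single edge would be the
     missed edge [E]. *)
  case: p ep up lp => [|c [|d p]] //= => [_ _ eq_ab|/andP[+ _] _ eq_cb].
    by rewrite eq_ab eqxx in ab.
  by rewrite -eq_cb /e' /edge_rel -defE (negPf EnF) andbF.
rewrite /ucycle up andbT /= rcons_path -lp.
apply/andP; split; last by rewrite edge_rel_sym /edge_rel ab -defE.
apply: sub_path ep => x y /andP[xy /(subsetP sub) ?]; exact/andP.
Qed.

End ParentMaps.

(** For any root, [parent_edges] is a bijection from parent maps to spanning trees. *)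
Lemma num_spanning_trees_parent_map (g : sgraph) (r : g) :
  num_spanning_trees g = #|[set f | parent_map r (@adj g) f]|.
Proof.
have adjE (x y : g) : [set x; y] \in edges g -> adj x y.
  rewrite inE => /existsP[u /existsP[v /andP[uv /eqP /set2_eq[[-> ->]|[-> ->]]]]] //.
  by rewrite adj_sym.
rewrite -(card_in_imset (f := parent_edges r)) => [|f h]; last first.
  by rewrite !inE; apply: parent_edges_inj.
apply: eq_card => F; rewrite inE; apply/idP/imsetP; last first.
  case=> f; rewrite inE => fP ->; apply/and3P; split.
  - apply/subsetP=> _ /imsetP[i ri ->]; rewrite !inE in ri.
    rewrite inE; apply/existsP; exists i; apply/existsP; exists (f i).
    by have [_ /forall_inP fe _] := and3P fP; rewrite fe ?eqxx.
  - by apply: parent_edges_connected fP; apply: adj_irr.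
  - exact: parent_edges_acyclic fP.
case/and3P=> sF conn acyc.
have [||f fP ->] := spanning_tree_parent_map (e := @adj g) r _ conn acyc.
- by move=> x y /andP[_ /(subsetP sF)/adjE].
- apply/subsetP=> E /(subsetP sF); rewrite inE => /existsP[u /existsP[v /andP[uv /eqP->]]].
  apply/imsetP; exists (u, v) => //; rewrite inE /=.
  by apply: contraTneq uv => ->; rewrite adj_irr.
by exists f; rewrite ?inE.
Qed.

(** * The matrix-tree theorem *)

Section Determinants.

Import GRing.Theory Num.Theory.
Local Open Scope ring_scope.

Lemma sum_enum_val (V : finType) (F : V -> rat) :
  \sum_(i < #|V|) F (enum_val i) = \sum_x F x.
Proof. by rewrite -(big_enum_val (A := V)). Qed.

Section MatrixTree.

Variables (V : finType) (r : V).
Local Notation n := #|V|.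

(** The identity minus the 0/1 matrix of [f], except for a unit row at the root. *)
Definition step_mx (f : {ffun V -> V}) : 'M[rat]_n :=
  \matrix_(i, j) ((enum_val j == enum_val i)%:R
    - ((enum_val i != r) && (enum_val j == f (enum_val i)))%:R).

(* The root is kept as an index, with a unit row, instead of being deleted. *)
Definition root_rel (e : rel V) : rel V :=
  fun i j => if i == r then j == r else e i j.

(** Away from the root this is degree matrix minus adjacency matrix; each row is written as a sum
    over neighbours so that multilinearity applies directly. *)
Definition reduced_laplacian (e : rel V) : 'M[rat]_n :=
  \matrix_(i, j) \sum_(k | root_rel e (enum_val i) k)
    ((enum_val j == enum_val i)%:R - ((enum_val i != r) && (enum_val j == k))%:R).

(** Multilinearity in the rows: choosing one summand in each row amounts to choosing a map [f]. *)
Lemma det_reduced_laplacian e :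
  \det (reduced_laplacian e) =
  \sum_(f : {ffun V -> V} | [forall i, root_rel e i (f i)]) \det (step_mx f).
Proof.
pose ext (f : {ffun V -> V}) : {ffun 'I_n -> V} := [ffun i => f (enum_val i)].
have ext_bij : bijective ext.
  exists (fun g : {ffun 'I_n -> V} => [ffun x => g (enum_rank x)]) => f.
    by apply/ffunP=> x; rewrite !ffunE enum_rankK.
  by apply/ffunP=> x; rewrite !ffunE enum_valK.
pose Q (i : 'I_n) := [pred k | root_rel e (enum_val i) k].
pose D (i j : 'I_n) (k : V) : rat :=
  (enum_val j == enum_val i)%:R - ((enum_val i != r) && (enum_val j == k))%:R.
transitivity (\sum_(s : 'S_n) \sum_(f : {ffun 'I_n -> V} | f \in family Q)
    (-1) ^+ s * \prod_i D i (s i) (f i)).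
  apply: eq_bigr => s _; rewrite -mulr_sumr -(bigA_distr_big_dep Q (fun i k => D i (s i) k)) /=.
  by congr (_ * _); apply: eq_bigr => i _; rewrite mxE.
rewrite exchange_big /= (reindex ext) /=; last exact: onW_bij.
apply: eq_big => [f | f _].
  apply/familyP/forallP=> fQ i; last by rewrite ffunE; apply: fQ.
  by have := fQ (enum_rank i); rewrite ffunE inE enum_rankK.
apply: eq_bigr => s _; congr (_ * _); apply: eq_bigr => i _.
by rewrite mxE ffunE.
Qed.

(* A permutation contributing to the determinant sends every point it moves to
   its parent, so a moved point of minimal rank cannot exist. *)
Lemma det_step_mx_acyclic (h : V -> nat) (f : {ffun V -> V}) :
  (forall i, i != r -> (h (f i) < h i)%N) -> \det (step_mx f) = 1.
Proof.
move=> hP; rewrite /determinant (bigD1 1%g) //= odd_perm1 mul1r big1 => [|i _].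
  rewrite big1 ?addr0 // => s s1.
  have [i0 mv0] : exists i, s i != i.
    apply/existsP; apply: contraR s1; rewrite negb_exists => /forallP fix_s.
    by apply/eqP/permP=> i; rewrite perm1; apply/eqP; rewrite -[_ == _]negbK.
  case: (@arg_minnP _ i0 (fun i => s i != i) (fun i => h (enum_val i)) mv0).
  move=> i mvi imin; apply/eqP; rewrite mulf_eq0 prodf_seq_eq0.
  apply/orP; right; apply/hasP; exists i; rewrite ?mem_index_enum //=.
  rewrite mxE (inj_eq enum_val_inj) (negPf mvi) sub0r oppr_eq0 pnatr_eq0 eqb0.
  apply/negP=> /andP[ri /eqP fi].
  have := imin (s i); rewrite (inj_eq perm_inj) => /(_ mvi).
  by rewrite fi leqNgt hP.
rewrite mxE perm1 eqxx; case: eqVneq => [|ri] /=; first by rewrite subr0.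
case: eqVneq => [fi|_]; last by rewrite subr0.
by have := hP _ ri; rewrite -fi ltnn.
Qed.

(* The indicator function of the points that never reach the root is in the
   kernel. *)
Lemma det_step_mx_cyclic (f : {ffun V -> V}) i :
  f r = r -> ~~ fconnect f i r -> \det (step_mx f) = 0.
Proof.
move=> fr ir; apply/eqP; rewrite -det_tr; apply/det0P.
pose w x : rat := (~~ fconnect f x r)%:R.
exists (\row_j w (enum_val j)).
  apply: contraNneq ir => /rowP/(_ (enum_rank i)); rewrite !mxE enum_rankK /w.
  by case: (fconnect f i r) =>  // /eqP; rewrite oner_eq0.
apply/rowP=> k; rewrite !mxE.
set x := enum_val k.
pose G y := w y * ((y == x)%:R - ((x != r) && (y == f x))%:R).
rewrite (eq_bigr (G \o enum_val)) => [|j _]; last by rewrite !mxE.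
rewrite sum_enum_val /G; under eq_bigr do rewrite mulrBr.
rewrite big_split sumrN /=.
rewrite (bigD1 x) //= eqxx mulr1 big1 ?addr0; last first.
  by move=> j /negPf->; rewrite mulr0.
have [xr | xr] := eqVneq x r.
  rewrite big1 ?subr0 => [|j _]; last by rewrite mulr0.
  by rewrite xr /w connect0.
rewrite (bigD1 (f x)) //= eqxx mulr1 big1 ?addr0; last first.
  by move=> j /negPf->; rewrite mulr0.
rewrite /w; suff -> : fconnect f x r = fconnect f (f x) r by rewrite subrr.
apply/idP/idP=> [|]; last exact: connect_trans (fconnect1 f x).
case/connectP=> -[|y p] /=; first by move=> _ eq_rx; rewrite eq_rx eqxx in xr.
by case/andP=> /eqP-> yp ->; apply/connectP; exists p.
Qed.

End MatrixTree.

(** Kirchhoff's theorem: in the expansion, a map [f] under which every vertex reaches the root is a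
    parent map and contributes 1; the others contribute 0. *)
Lemma num_spanning_trees_det (g : sgraph) (r : g) :
  (num_spanning_trees g)%:R = \det (reduced_laplacian r (@adj g)).
Proof.
rewrite (num_spanning_trees_parent_map r) det_reduced_laplacian -sum1_card natr_sum.
rewrite big_mkcond [RHS]big_mkcond /=; apply: eq_bigr => f _; rewrite inE.
case: ifP => [fP | /negbT fP].
  rewrite ifT; last first.
    case/and3P: fP => fr /forall_inP fe _; apply/forallP=> i; rewrite /root_rel.
    by case: eqVneq => [-> // | /fe].
  by have [h /det_step_mx_acyclic->] := parent_map_ranking fP.
case: ifP => // /forallP fQ.
have fr : f r = r by have := fQ r; rewrite /root_rel eqxx => /eqP.
have [/forallP f_root | /forallPn[i ir]] := boolP [forall i, fconnect f i r].
  case/and3P: fP; split; first exact/eqP.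
    by apply/forall_inP=> i ri; have := fQ i; rewrite /root_rel (negPf ri).
  exact/forallP.
by rewrite (det_step_mx_cyclic fr ir).
Qed.

(** * Joins of a complete graph with disjoint complete graphs *)

(** Both [X *m Y] and [Y *m X] are block upper triangular, their only nontrivial diagonal blocks
    being [1 - A B] and [1 - B A] respectively. *)
Lemma det_1_sub_mulmxC (R : comNzRingType) p q (A : 'M[R]_(p, q)) (B : 'M[R]_(q, p)) :
  \det (1%:M - A *m B) = \det (1%:M - B *m A).
Proof.
pose X := block_mx 1%:M A B 1%:M; pose Y := block_mx 1%:M 0 (- B) 1%:M.
have <- : \det (X *m Y) = \det (1%:M - A *m B).
  rewrite mulmx_block !mulmx1 !mul1mx !mulmx0 !add0r mulmxN subrr.
  by rewrite det_ublock det1 mulr1.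
have <- : \det (Y *m X) = \det (1%:M - B *m A).
  rewrite mulmx_block !mulmx1 !mul1mx !mul0mx !addr0 addNr mulNmx [- _ + _]addrC.
  by rewrite det_ublock det1 mul1r.
by rewrite !det_mulmx mulrC.
Qed.

(** Column operations by the inverse of the diagonal block clear [c] and leave its Schur
    complement. *)
Lemma det_arrow_mx (F : fieldType) t (a : F) (b : 'rV_t) (c : 'cV_t) (d : 'rV_t) :
  (forall i, d 0 i != 0) ->
  \det (block_mx a%:M b c (diag_mx d) : 'M_(1 + t)) =
  (a - \sum_i b 0 i * c i 0 / d 0 i) * \prod_i d 0 i.
Proof.
move=> dn0; pose e := diag_mx (\row_i (d 0 i)^-1).
have := det_mulmx (block_mx a%:M b c (diag_mx d)) (block_mx 1%:M 0 (- (e *m c)) 1%:M).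
rewrite [\det (block_mx 1%:M _ _ _)]det_lblock !det1 !mulr1 => <-.
have de : diag_mx d *m e = 1%:M.
  rewrite mulmx_diag; apply/matrixP=> i j; rewrite !mxE.
  by rewrite divff.
rewrite mulmx_block !mulmx1 !mulmx0 !add0r !mulmxN !mulmxA de mul1mx subrr.
rewrite det_ublock det_diag; congr (_ * _).
rewrite det_mx11 /e mul_mx_diag !mxE eqxx; congr (_ - _).
by apply: eq_bigr => i _; rewrite !mxE mulrAC.
Qed.

Section Join.

(** The colour [None] marks the vertices joined to all others, and [Some i] those of the [i]-th
    complete graph. *)
Variables (g : sgraph) (t : nat) (c : g -> option 'I_t).
Let m := #|[set x | c x == None]|.
Let s i := #|[set x | c x == Some i]|.

Hypothesis adjE : forall x y : g,
  adj x y = (x != y) && [|| c x == None, c y == None | c x == c y].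
Hypotheses (m_gt0 : (0 < m)%N) (t_gt0 : (0 < t)%N) (s_gt0 : forall i, (0 < s i)%N).

Let n := #|g|.
Let w o := if o is Some i then (m + s i)%N else n.

Lemma card_join : n = (m + \sum_i s i)%N.
Proof.
have -> : n = \sum_(x : g) 1 by rewrite sum1_card.
rewrite (bigID (fun x => c x == None)) /=; congr (_ + _)%N.
  by rewrite sum1dep_card.
have sE i : s i = \sum_(x | c x == Some i) 1 by rewrite sum1dep_card.
under [RHS]eq_bigr do rewrite sE.
rewrite (exchange_big_dep (fun x => c x != None)) /= => [|i x _ /eqP-> //].
apply: eq_bigr => x; case: (c x) => // j _.
by rewrite (bigD1 j) ?eqxx //= big1 // => i /andP[/eqP[->]]; rewrite eqxx.
Qed.

Lemma card_closed_nbhd x :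
  #|[set y | [|| c x == None, c y == None | c x == c y]]| = w (c x).
Proof.
case: (c x) => [i|] /=; last first.
  by rewrite /n -cardsT; apply: eq_card => y; rewrite !inE.
rewrite /m /s -cardsUI (_ : _ :&: _ = set0) ?cards0 ?addn0.
  by apply: eq_card => y; rewrite !inE [_ == c y]eq_sym.
by apply/setP=> y; rewrite !inE; case: (c y).
Qed.

Lemma num_spanning_trees_join :
  num_spanning_trees g =
  (n ^ m.-1 * m ^ t.-1 * \prod_i (m + s i) ^ (s i).-1)%N.
Proof.
have [r /eqP cr] : exists r, c r == None.
  by case/card_gt0P: m_gt0 => r; rewrite inE; exists r.
have w_gt0 o : (0 < w o)%N.
  by case: o => [i|]; rewrite /w ?addn_gt0 ?m_gt0 // card_join addn_gt0 m_gt0.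
have w_neq0 o : (w o)%:R != 0 :> rat by rewrite pnatr_eq0 -lt0n.
have mE : m = #|[predD1 [set x | c x == None] & r]|.+1.
  by rewrite /m (cardD1 r) inE cr.
(* Away from the root, the degree plus one: it is the closed adjacency matrix that factors through
   the colours. *)
pose dg (x : g) : rat := if x == r then 1 else (w (c x))%:R.
have dg_neq0 x : dg x != 0 by rewrite /dg; case: ifP; rewrite ?oner_eq0.
pose D : 'M[rat]_n := diag_mx (\row_j dg (enum_val j)).
pose D' : 'M[rat]_n := diag_mx (\row_j (dg (enum_val j))^-1).
(* [u] records the colour of a vertex and kills the root, while [v] tells whether a colour class is
   joined to a vertex. So [U *m W] is the closed adjacency matrix with a zero row at the root. *)
pose u x (o : option 'I_t) : rat := ((x != r) && (c x == o))%:R.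
pose v (o : option 'I_t) x : rat := [|| c x == None, o == None | c x == o]%:R.
pose U : 'M[rat]_(n, 1 + t) :=
  row_mx (\col_i u (enum_val i) None) (\matrix_(i, j) u (enum_val i) (Some j)).
pose W : 'M[rat]_(1 + t, n) :=
  col_mx (\row_i v None (enum_val i)) (\matrix_(j, i) v (Some j) (enum_val i)).
have LE : reduced_laplacian r (@adj g) = D *m (1%:M - (D' *m U) *m W).
  have DK : D *m D' = 1%:M.
    by rewrite mulmx_diag; apply/matrixP=> i j; rewrite !mxE divff.
  rewrite mulmxBr mulmx1 !mulmxA DK mul1mx mul_row_col.
  apply/matrixP=> i j; rewrite !mxE big_ord1 !mxE.
  under [X in _ - (_ + X)]eq_bigr do rewrite !mxE.
  rewrite -(inj_eq enum_val_inj); move: (enum_val i) (enum_val j) => x y {i j}.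
  have -> : u x None * v None y + \sum_k u x (Some k) * v (Some k) y =
      ((x != r) && [|| c x == None, c y == None | c x == c y])%:R.
    rewrite /u /v; case cx: (c x) => [k|] /=.
      rewrite andbF mul0r add0r (bigD1 k) //= eqxx andbT -natrM mulnb.
      rewrite big1 ?addr0 => [|k' ne_k'].
        by rewrite [c y == Some k]eq_sym.
      have /negPf-> : Some k != Some k' by apply: contra ne_k' => /eqP[->].
      by rewrite andbF mul0r.
    by rewrite big1 ?addr0 ?orbT ?mulr1 // => k _; rewrite andbF mul0r.
  rewrite [y == x]eq_sym /root_rel /dg; case: eqVneq => [-> | xr] /=.
    by rewrite big_pred1_eq !subr0.
  rewrite -(card_closed_nbhd x) sumrB.
  rewrite sumr_const -[_ *+ _]mulr_natl.
  have -> : \sum_(k | adj x k) (y == k)%:R = (adj x y)%:R :> rat.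
    rewrite big_mkcond (bigD1 y) //= eqxx big1 ?addr0 => [|k /negPf yk].
      by case: (adj x y).
    by rewrite eq_sym yk if_same.
  rewrite (cardsD1 x) inE eqxx orbT /= (eq_card (B := @adj g x)); last first.
    by move=> k; rewrite !inE [RHS]adjE eq_sym.
  rewrite adjE; case: (eqVneq x y) => [-> | _] /=; last by rewrite mulr0.
  by rewrite eqxx !orbT natrD addrAC subrr add0r mulr1 subr0.
(* The root contributes 1, so only [m - 1] factors equal [n]. *)
have prod_dg : \prod_(i < n) dg (enum_val i) = (n ^ m.-1 * \prod_i (m + s i) ^ s i)%:R :> rat.
  rewrite -(big_enum_val (A := g)) /= (bigID (fun x => c x == None)) /=.
  rewrite natrM natrX natr_prod; congr (_ * _).
    rewrite (bigD1 r) /= ?cr // /dg eqxx mul1r.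
    rewrite (eq_bigr (fun=> n%:R)) => [|x /andP[/eqP-> /negPf->] //].
    rewrite prodr_const; congr (_ ^+ _).
    rewrite mE /=; apply: eq_card => x.
    by rewrite !inE andbC.
  (* The default colour is harmless: vertices of colour [None] have been split off. *)
  rewrite (partition_big (fun x => odflt (Ordinal t_gt0) (c x)) predT) //=.
  apply: eq_bigr => i _; rewrite natrX.
  have s_cond x : (c x != None) && (odflt (Ordinal t_gt0) (c x) == i) = (c x == Some i).
    by case: (c x).
  rewrite (eq_bigl _ _ s_cond) (eq_bigr (fun=> (m + s i)%:R)) => [|x /eqP cx].
    by rewrite prodr_const /s cardsE.
  by rewrite /dg cx; case: eqVneq cx => // ->; rewrite cr.
(* Distinct complete graphs are not joined, so the block on their colours is diagonal; the removed
   root explains [m - 1] in the first column. *)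
have WDU : 1%:M - W *m (D' *m U) =
    block_mx (1 - m.-1%:R / n%:R)%:M (\row_i (- ((s i)%:R / (m + s i)%:R)))
             (\col_i (- (m.-1%:R / n%:R))) (diag_mx (\row_i (m%:R / (m + s i)%:R))).
  have sumN o : \sum_(i < n) v o (enum_val i) * ((dg (enum_val i))^-1 * u (enum_val i) None)
      = m.-1%:R / n%:R.
    rewrite (sum_enum_val (fun x => v o x * ((dg x)^-1 * u x None))).
    rewrite (bigID (fun x => (x != r) && (c x == None))) /= addrC big1 => [|x]; last first.
      by rewrite /u => /negPf->; rewrite !mulr0.
    rewrite add0r (eq_bigr (fun=> n%:R^-1)) => [|x /andP[xr /eqP cx]]; last first.
      by rewrite /v /u /dg xr cx (negPf xr) mul1r mulr1.
    rewrite sumr_const -[_ *+ _]mulr_natl; congr (_%:R * _).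
    rewrite mE /=; apply: eq_card => x.
    by rewrite !inE.
  have sumS o k : \sum_(i < n) v o (enum_val i) * ((dg (enum_val i))^-1 * u (enum_val i) (Some k))
      = ((o == None) || (o == Some k))%:R * ((s k)%:R / (m + s k)%:R).
    rewrite (sum_enum_val (fun x => v o x * ((dg x)^-1 * u x (Some k)))).
    rewrite (bigID (fun x => c x == Some k)) /= addrC big1 => [|x]; last first.
      by rewrite /u => /negPf->; rewrite andbF !mulr0.
    pose b := (o == None) || (o == Some k).
    rewrite add0r (eq_bigr (fun=> b%:R * (m + s k)%:R^-1)) => [|x /eqP cx]; last first.
      have xr : x != r by apply: contra_eq_neq cx => ->; rewrite cr.
      rewrite /v /u /dg (negPf xr) cx eqxx /= mulr1; congr (_%:R * _).
      by rewrite /b [Some k == o]eq_sym.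
    by rewrite sumr_const -[_ *+ _]mulr_natl mulrCA /s cardsE.
  rewrite mul_mx_row mul_col_row scalar_mx_block opp_block_mx add_block_mx /D'.
  rewrite !mul_diag_mx; congr block_mx; apply/matrixP=> i j; rewrite !mxE.
  - rewrite !ord1 eqxx; congr (_ - _).
    by rewrite -[RHS](sumN None); apply: eq_bigr => x _; rewrite !mxE.
  - rewrite sub0r; congr (- _); rewrite -[RHS]mul1r -[RHS](sumS None).
    by apply: eq_bigr => x _; rewrite !mxE.
  - rewrite sub0r; congr (- _); rewrite -[RHS](sumN (Some i)).
    by apply: eq_bigr => x _; rewrite !mxE.
  rewrite (eq_bigr (fun x => v (Some i) (enum_val x) *
    ((dg (enum_val x))^-1 * u (enum_val x) (Some j)))) => [|x _]; last by rewrite !mxE.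
  rewrite sumS /=; case: (eqVneq i j) => [->|ij].
    rewrite eqxx mul1r natrD /=; field; rewrite -natrD; exact: w_neq0 (Some j).
  have /negPf-> : Some i != Some j by apply: contra ij => /eqP[->].
  by rewrite mul0r subr0.
apply/eqP; rewrite -(eqr_nat rat); apply/eqP.
rewrite (num_spanning_trees_det r) LE det_mulmx det_diag det_1_sub_mulmxC WDU.
have m_neq0 : m%:R != 0 :> rat by rewrite pnatr_eq0 -lt0n.
have ws_neq0 i : (m + s i)%:R != 0 :> rat by apply: (w_neq0 (Some i)).
have n_neq0 : n%:R != 0 :> rat by apply: (w_neq0 None).
rewrite det_arrow_mx => [|i]; last by rewrite mxE mulf_neq0 ?invr_eq0.
under eq_bigr do rewrite mxE; rewrite prod_dg.
rewrite (eq_bigr (fun i => m.-1%:R / (n%:R * m%:R) * (s i)%:R)) => [|i _]; last first.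
  by rewrite !mxE; field; rewrite -natrD n_neq0 m_neq0 ws_neq0.
rewrite -mulr_sumr -natr_sum.
under [X in _ * (_ * X)]eq_bigr do rewrite mxE.
have -> : (\sum_i s i)%:R = n%:R - m%:R :> rat by rewrite card_join natrD addrC addKr.
rewrite prodf_div prodr_const card_ord.
have -> : m.-1%:R = m%:R - 1 :> rat by rewrite -[in RHS](prednK m_gt0) -natr1 addrK.
(* The Schur complement [1 - (m - 1) / n - (m - 1) (n - m) / (n m)] collapses to [1 / m]. *)
rewrite [X in _ * (X * _)](_ : _ = m%:R^-1); last by field; rewrite n_neq0 m_neq0.
rewrite -[t in _ ^+ t](prednK t_gt0) exprS -!natr_prod.
have prodE : (\prod_i (m + s i) ^ s i = (\prod_i (m + s i)) * \prod_i (m + s i) ^ (s i).-1)%N.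
  by rewrite -big_split; apply: eq_bigr => i _; rewrite /= -expnS prednK.
have P_neq0 : (\prod_i (m + s i))%:R != 0 :> rat.
  by rewrite natr_prod; apply/prodf_neq0.
rewrite prodE !natrM !natrX.
by field; rewrite m_neq0 P_neq0.
Qed.

End Join.

End Determinants.

(** * Groups whose noncentral elements have abelian centralizers *)

Section Centralizers.

Variables (gT : finGroupType) (G : {group gT}).
Local Notation Z := 'Z(G)%g.

Lemma mem_centralizer x y : x \in G -> y \in G -> (y \in 'C_G[x]) = (x * y == y * x)%g.
Proof.
by move=> Gx Gy; rewrite inE Gy; apply/cent1P/eqP => [/commute_sym|/commute_sym].
Qed.

Lemma centralizer_center x : x \in Z -> 'C_G[x]%g = G.
Proof.
case/centerP=> Gx cGx; apply/setP=> y; rewrite inE.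
by case Gy: (y \in G) => //=; apply/cent1P/commute_sym/cGx.
Qed.

Lemma centralizer_eqG x : x \in G -> 'C_G[x]%g = G -> x \in Z.
Proof.
move=> Gx CG; apply/centerP; split=> // y; rewrite -{1}CG inE => /andP[_ /cent1P].
exact: commute_sym.
Qed.

Lemma center_sub_centralizer x : x \in G -> Z \subset 'C_G[x]%g.
Proof.
move=> Gx; apply/subsetP=> z /centerP[Gz cGz]; rewrite inE Gz.
by apply/cent1P/cGz.
Qed.

Lemma card_subg_preim (A : {set gT}) :
  #|[set x : subg_of G | sgval x \in A]| = #|G :&: A|.
Proof.
rewrite -(card_imset _ (@subg_inj _ G)); apply: eq_card => y.
apply/imsetP/setIP => [[x + ->] | [Gy Ay]]; first by rewrite inE subgP.
by exists (subg G y); rewrite ?inE subgK.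
Qed.

Hypothesis abel_cent : forall x, x \in G :\: Z -> abelian 'C_G[x]%g.

(** Each of the two centralizers is abelian and contains both [x] and [y], hence lies in the
    other. *)
Lemma eq_centralizer x y :
  x \in G :\: Z -> y \in 'C_G[x]%g :\: Z -> 'C_G[x]%g = 'C_G[y]%g.
Proof.
move=> xGZ /setDP[yCx yZ]; have /setDP[Gx _] := xGZ.
have Gy : y \in G by case/setIP: yCx.
have xCy : x \in 'C_G[y]%g by rewrite mem_centralizer // eq_sym -mem_centralizer.
have yGZ : y \in G :\: Z by rewrite inE yZ.
apply/eqP; rewrite eqEsubset !subsetI !subsetIl !andTb; apply/andP; split.
  by rewrite sub_cent1 (subsetP (abel_cent xGZ)).
by rewrite sub_cent1 (subsetP (abel_cent yGZ)).
Qed.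

(** Thus commuting is an equivalence relation on the noncentral elements, with these sets as its
    classes. *)
Lemma centralizer_fiber x : x \in G :\: Z ->
  [set y in G :\: Z | 'C_G[y]%g == 'C_G[x]%g] = 'C_G[x]%g :\: Z.
Proof.
move=> xGZ; apply/setP=> y; rewrite inE; apply/andP/idP => [[yGZ /eqP<-] | yCx].
  by have /setDP[Gy yZ] := yGZ; apply/setDP; rewrite mem_centralizer.
have /setDP[/setIP[Gy _] yZ] := yCx.
by rewrite (eq_centralizer xGZ yCx) eqxx; split=> //; apply/setDP.
Qed.

Lemma sum_centralizer_sizes : sumn (centralizer_sizes G) = #|G :\: Z|.
Proof.
rewrite sumnE big_map big_enum -sum1_card.
rewrite (partition_big (fun x => 'C_G[x]%g) (mem (noncentral_centralizers G))) /=.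
  apply: eq_bigr => C /imsetP[x xGZ ->].
  by rewrite -(centralizer_fiber xGZ) sum1dep_card.
by move=> x xGZ; apply: imset_f.
Qed.

Lemma kappaE : ~~ abelian G ->
  kappa G = #|G| ^ #|Z|.-1 * #|Z| ^ (size (centralizer_sizes G)).-1 *
            \prod_(s <- centralizer_sizes G) (#|Z| + s) ^ s.-1.
Proof.
move=> nab.
(* A noncentral element supplies the default for [enum_rank_in] and shows that there is at least one
   centralizer. *)
have [x0 x0GZ] : exists x, x \in G :\: Z.
  apply/set0Pn; rewrite setD_eq0; apply: contra nab => GZ.
  by apply/center_idP/eqP; rewrite eqEsubset center_sub.
have C0 : 'C_G[x0]%g \in noncentral_centralizers G by apply: imset_f.
(* This colouring exhibits the join, as noncentral elements commute exactly when their centralizers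
   coincide. *)
pose c (x : subg_of G) := if sgval x \in Z then None
  else Some (enum_rank_in C0 'C_G[sgval x]%g).
have c_None x : (c x == None) = (sgval x \in Z) by rewrite /c; case: ifP.
have c_Some x (i : 'I_#|noncentral_centralizers G|) : (c x == Some i) =
    (sgval x \in [set y in G :\: Z | 'C_G[y]%g == enum_val i]).
  rewrite /c !inE subgP; case: ifP => //= xZ.
  apply/eqP/eqP => [[<-] | ->]; last by rewrite enum_valK_in.
  by rewrite enum_rankK_in //; apply: imset_f; rewrite !inE subgP xZ.
have fiberE (i : 'I_#|noncentral_centralizers G|) : [set y in G :\: Z | 'C_G[y]%g == enum_val i] = enum_val i :\: Z.
  by have /imsetP[x xGZ ->] := enum_valP i; apply: centralizer_fiber.
have mE : #|[set x | c x == None]| = #|Z|.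
  under eq_finset do rewrite c_None.
  by rewrite card_subg_preim (setIidPr (center_sub G)).
have sE (i : 'I_#|noncentral_centralizers G|) : #|[set x | c x == Some i]| = #|enum_val i :\: Z|.
  under eq_finset do rewrite c_Some fiberE.
  rewrite card_subg_preim (setIidPr _) //.
  have /imsetP[x _ ->] := enum_valP i.
  exact: subset_trans (subsetDl _ _) (subsetIl _ _).
rewrite /kappa (@num_spanning_trees_join (commuting_graph G) _ c).
- have -> : #|commuting_graph G| = #|G|.
    rewrite -(setIid G) -card_subg_preim -cardsT.
    by apply: eq_card => x; rewrite !inE subgP.
  rewrite mE size_map -cardE big_map big_enum /= [in RHS]big_enum_val.
  by congr (_ * _); apply: eq_bigr => i _; rewrite sE.
- move=> x y; rewrite !c_None /= /commuting; congr (_ && _).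
  rewrite -(inj_eq (@subg_inj _ G)) /= -mem_centralizer ?subgP //.
  case xZ: (sgval x \in Z); first by rewrite centralizer_center ?subgP.
  case yZ: (sgval y \in Z) => /=.
    by apply: (subsetP (center_sub_centralizer (subgP x))).
  have xGZ : sgval x \in G :\: Z by rewrite inE xZ subgP.
  have yGZ : sgval y \in G :\: Z by rewrite inE yZ subgP.
  have -> : (c x == c y) = ('C_G[sgval y]%g == 'C_G[sgval x]%g).
    rewrite /c xZ yZ; apply/eqP/eqP => [[]|-> //].
    by move/(enum_rank_in_inj (imset_f _ xGZ) (imset_f _ yGZ)).
  apply/idP/eqP => [yCx | <-]; last by rewrite mem_centralizer ?subgP.
  by apply/esym/eq_centralizer => //; apply/setDP; rewrite yZ.
- by rewrite mE cardG_gt0.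
- by apply/card_gt0P; exists 'C_G[x0]%g.
move=> i; rewrite sE; have /imsetP[x xGZ ->] := enum_valP i.
apply/card_gt0P; exists x; have /setDP[Gx xZ] := xGZ.
by apply/setDP; rewrite mem_centralizer.
Qed.

End Centralizers.

(** * Centralizers in a group with an abelian subgroup of index 2 *)

Lemma prime_index_sub (gT : finGroupType) (G H K : {group gT}) :
    prime #|G : H| -> H \subset K -> K \subset G -> K :=: H \/ K :=: G.
Proof.
move=> pr HK KG; have := Lagrange_index KG HK => /esym def_p.
have : #|K : H| %| #|G : H| by rewrite def_p dvdn_mull.
case/primeP: pr => p_gt1 p_div /p_div/orP[/eqP iKH | /eqP iKH].
  by left; rewrite (index1g HK iKH).
right; apply: index1g => //; move: def_p; rewrite iKH.
by nia.
Qed.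

(** The quotient by [H] has prime order, hence is cyclic, and a cyclic quotient by a central
    subgroup forces commutativity. *)
Lemma central_index_prime_abelian (gT : finGroupType) (G H : {group gT}) :
  H \subset 'Z(G)%g -> prime #|G : H| -> abelian G.
Proof.
move=> HZ pr; apply: (cyclic_factor_abelian HZ).
apply: prime_cyclic; rewrite card_quotient //.
exact/normal_norm/sub_center_normal.
Qed.

Section IndexTwo.

Variables (gT : finGroupType) (G H : {group gT}).
Hypotheses (sHG : H \subset G) (abH : abelian H) (iH : #|G : H| = 2).
Hypothesis nabG : ~~ abelian G.
Local Notation Z := 'Z(G)%g.

Let prH : prime #|G : H|. Proof. by rewrite iH. Qed.

Lemma index2_sub_centralizer x : x \in H -> H \subset 'C_G[x]%g.
Proof. by move=> Hx; rewrite subsetI sHG sub_cent1 (subsetP abH). Qed.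

(** A central element outside [H] would generate with [H] a larger abelian subgroup, hence all of
    [G]. *)
Lemma center_sub_index2 : Z \subset H.
Proof.
apply: contraR nabG => /subsetPn[z zZ zH]; have /centerP[Gz cGz] := zZ.
have Hz : H \subset 'C_G[z]%g by rewrite centralizer_center.
have abHz : abelian (H <*> <[z]>).
  rewrite abelianY abH cycle_abelian /= cycle_subG.
  by apply/centP=> h Hh; apply: cGz; apply: (subsetP sHG).
have [|eqH|<- //] := prime_index_sub prH (joing_subl H <[z]>).
  by rewrite join_subG sHG cycle_subG.
by case/negP: zH; rewrite -eqH (subsetP (joing_subr _ _)) ?cycle_id.
Qed.

Lemma centralizer_index2_in x : x \in H :\: Z -> 'C_G[x]%g = H.
Proof.
case/setDP=> Hx xZ; have Gx := subsetP sHG x Hx.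
have [//|] := prime_index_sub prH (index2_sub_centralizer Hx) (subsetIl _ _).
by move/(centralizer_eqG Gx) => xZ'; rewrite xZ' in xZ.
Qed.

(** An element of [H] commuting with [x] has a centralizer containing [H] and [x], hence equal to
    [G]. *)
Lemma centralizer_index2_meet x : x \in G :\: H -> 'C_G[x]%g :&: H = Z.
Proof.
case/setDP=> Gx xH; apply/eqP; rewrite eqEsubset subsetI.
rewrite center_sub_centralizer // center_sub_index2 !andbT.
apply/subsetP=> z /setIP[zC Hz]; have Gz := subsetP sHG z Hz.
apply: centralizer_eqG => //.
have [eqC|//] := prime_index_sub prH (index2_sub_centralizer Hz) (subsetIl _ _).
by case/negP: xH; rewrite -eqC mem_centralizer // eq_sym -(@mem_centralizer _ G).
Qed.

(** Since [x] lies outside [H], the product of [C_G(x)] and [H] is [G]; their intersection is [Z],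
    so the product formula gives the order. *)
Lemma card_centralizer_index2_out x : x \in G :\: H -> #|'C_G[x]%g| = 2 * #|Z|.
Proof.
move=> xGH; have [Gx xH] := setDP xGH.
have nH : H <| G by apply: index2_normal.
have CHG : ('C_G[x] * H = G)%g.
  rewrite -norm_joinEl; last first.
    by apply: subset_trans (subsetIl _ _) (normal_norm nH).
  have [|eqH|//] := prime_index_sub prH (joing_subr 'C_G[x]%g H).
    by rewrite join_subG sHG subsetIl.
  case/negP: xH; rewrite -eqH (subsetP (joing_subl _ _)) //.
  by rewrite mem_centralizer.
have := mul_cardG 'C_G[x]%G H; rewrite CHG centralizer_index2_meet // -(Lagrange sHG) iH.
move=> eqC; apply/eqP; rewrite -(eqn_pmul2r (cardG_gt0 H)).
by rewrite [X in X == _]eqC -mulnA mulnC.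
Qed.

(** For [x] outside [H], the center of [G] is a central subgroup of index 2 in [C_G(x)]. *)
Lemma abelian_centralizer_index2 x : x \in G :\: Z -> abelian 'C_G[x]%g.
Proof.
case/setDP=> Gx xZ; have [Hx | xH] := boolP (x \in H).
  by rewrite centralizer_index2_in // inE xZ.
have xGH : x \in G :\: H by rewrite inE xH.
apply: (@central_index_prime_abelian _ _ 'Z(G)%G).
  rewrite /= subsetI center_sub_centralizer //= centsC.
  by apply: subset_trans (subsetIl _ _) _; rewrite centsC subsetIr.
rewrite -divgS ?center_sub_centralizer //= card_centralizer_index2_out //.
by rewrite mulnK.
Qed.

(** One centralizer is [H], and each of the [c] others contributes [2 |Z| - |Z|]. Counting [G :\: Z]
    gives [(|H| - |Z|) + c |Z| = 2 |H| - |Z|], so [c = |H| / |Z|]. *)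
Lemma centralizer_sizes_index2 :
  perm_eq (centralizer_sizes G) ((#|H| - #|Z|) :: nseq (#|H| %/ #|Z|) #|Z|).
Proof.
have [x0 x0HZ] : exists x, x \in H :\: Z.
  apply/set0Pn; rewrite setD_eq0; apply: contra nabG => HZ.
  exact: central_index_prime_abelian HZ prH.
have x0GZ : x0 \in G :\: Z by apply: subsetP (setSD _ sHG) _ x0HZ.
pose N := noncentral_centralizers G.
have HN : (H : {set gT}) \in N.
  by apply/imsetP; exists x0; rewrite ?centralizer_index2_in.
have permN : perm_eq (enum N) ((H : {set gT}) :: enum (N :\ (H : {set gT}))).
  apply: uniq_perm; rewrite /= ?enum_uniq ?mem_enum ?setD11 //= => C.
  by rewrite inE !mem_enum !inE; case: eqP => [->|].
have sizesE : perm_eq (centralizer_sizes G)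
    (#|H :\: Z| :: nseq #|N :\ (H : {set gT})| #|Z|).
  apply: perm_trans (perm_map _ permN) _; rewrite /= perm_cons.
  rewrite cardE -(size_map (fun C : {set gT} => #|C :\: Z|)).
  suff /all_pred1P <- : all (pred1 #|Z|)
    [seq #|C :\: Z| | C <- enum (N :\ (H : {set gT}))] by [].
  apply/allP=> _ /mapP[C + ->]; rewrite mem_enum => /setD1P[CH /imsetP[x xGZ CE]].
  have xGH : x \in G :\: H.
    rewrite inE; have /setDP[-> xZ] := xGZ; rewrite andbT.
    apply: contra CH => Hx; rewrite CE centralizer_index2_in //.
    by rewrite inE xZ.
  have /setDP[Gx _] := xGH.
  rewrite /= CE cardsD (setIidPr (center_sub_centralizer Gx)).
  by rewrite card_centralizer_index2_out // mul2n -addnn addnK.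
have := perm_sumn sizesE; rewrite sum_centralizer_sizes; last first.
  exact: abelian_centralizer_index2.
rewrite /= sumn_nseq [#|H :\: Z|]cardsD [#|G :\: Z|]cardsD (setIidPr (center_sub G)).
rewrite (setIidPr center_sub_index2) -(Lagrange sHG) iH => eqN.
have mH := subset_leq_card center_sub_index2.
have cH : #|H| = #|Z| * #|N :\ (H : {set gT})|.
  by move: eqN mH; move: #|H| #|Z| #|_ :\ _| => h m c; lia.
rewrite [in _ %/ _]cH mulKn ?cardG_gt0 //.
by move: sizesE; rewrite [#|H :\: Z|]cardsD (setIidPr center_sub_index2).
Qed.

End IndexTwo.

Lemma card_noncentral_centralizers (gT : finGroupType) (G : {group gT}) :
  #|noncentral_centralizers G| = size (centralizer_sizes G).
Proof. by rewrite size_map -cardE. Qed.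

Lemma big_nseq_muln n a (F : nat -> nat) : \prod_(s <- nseq n a) F s = F a ^ n.
Proof. by rewrite big_nseq iter_muln_1. Qed.

(** * Nonabelian groups of order p^3 *)

Section PCube.

Variables (gT : finGroupType) (G : {group gT}) (p : nat).
Hypotheses (pr_p : prime p) (nabG : ~~ abelian G) (oG : #|G| = p ^ 3).

(** A nonabelian group of order [p ^ 3] is extraspecial. *)
Lemma card_center_pcube : #|'Z(G)| = p.
Proof.
have pG : p.-group G by rewrite /pgroup oG pnatX pnat_id.
apply: (card_center_extraspecial pG (p3group_extraspecial pG nabG _)).
by rewrite oG pfactorK.
Qed.

(** The order is a power of [p] strictly between [|Z(G)| = p] and [p ^ 3], since the centralizer
    contains the noncentral [x] but is not [G]. *)
Lemma card_centralizer_pcube x : x \in G :\: 'Z(G) -> #|'C_G[x]| = p ^ 2.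
Proof.
case/setDP=> Gx xZ.
have /(dvdn_pfactor _ _ pr_p)[j le_j3 cC] : #|'C_G[x]| %| p ^ 3.
  by rewrite -oG cardSg ?subsetIl.
have j_neq3 : j != 3.
  apply: contra xZ => /eqP j3; apply: centralizer_eqG => //.
  by apply/eqP; rewrite eqEcard subsetIl /= oG cC j3.
have : #|'Z(G)| < #|'C_G[x]|.
  apply: proper_card; rewrite properE center_sub_centralizer //.
  by apply: contra xZ => /subsetP; apply; rewrite mem_centralizer.
rewrite card_center_pcube cC -{1}(expn1 p) ltn_exp2l ?(prime_gt1 pr_p) // => j_gt1.
by congr (_ ^ _); lia.
Qed.

Lemma abelian_centralizer_pcube x : x \in G :\: 'Z(G) -> abelian 'C_G[x].
Proof. by move/card_centralizer_pcube; apply: card_p2group_abelian. Qed.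

(** All sizes agree, and their number [t] solves [(p ^ 2 - p) t = p ^ 3 - p]. *)
Lemma centralizer_sizes_pcube : centralizer_sizes G = nseq (p + 1) (p ^ 2 - p).
Proof.
have p_gt1 := prime_gt1 pr_p.
have sizesE : centralizer_sizes G = nseq (size (centralizer_sizes G)) (p ^ 2 - p).
  apply/all_pred1P/allP=> _ /mapP[C + ->]; rewrite mem_enum => /imsetP[x xGZ ->].
  have /setDP[Gx _] := xGZ.
  rewrite /= cardsD (setIidPr (center_sub_centralizer Gx)).
  by rewrite card_centralizer_pcube // card_center_pcube.
move: (size _) sizesE => t sizesE; rewrite sizesE; congr nseq.
have := sum_centralizer_sizes abelian_centralizer_pcube; rewrite sizesE sumn_nseq.
rewrite cardsD (setIidPr (center_sub G)) card_center_pcube oG.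
move=> eqt.
have p2p_gt0 : 0 < p ^ 2 - p by nia.
apply/eqP; rewrite -(eqn_pmul2l p2p_gt0) eqt; apply/eqP.
by rewrite mulnBl !mulnDr !muln1 -expnSr -mulnn subnDA addnK.
Qed.

Lemma kappa_pcube : kappa G = p ^ (2 * p ^ 3 - 5).
Proof.
have p_gt1 := prime_gt1 pr_p.
rewrite (kappaE abelian_centralizer_pcube nabG) centralizer_sizes_pcube size_nseq.
rewrite big_nseq_muln card_center_pcube oG.
have -> : p + (p ^ 2 - p) = p ^ 2 by nia.
(* The exponents add up as [3 (p - 1) + p + 2 (p ^ 2 - p - 1) (p + 1) = 2 p ^ 3 - 5]. *)
rewrite -!expnM -!expnD; congr (_ ^ _); nia.
Qed.

End PCube.

(** * The tree count for an abelian subgroup of index 2 *)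

Lemma kappa_index2 (gT : finGroupType) (G H : {group gT}) :
    H \subset G -> abelian H -> #|G : H| = 2 -> ~~ abelian G ->
  kappa G = (2 * #|H|) ^ #|'Z(G)|.-1 * #|'Z(G)| ^ (#|H| %/ #|'Z(G)|) *
    (#|H| ^ (#|H| - #|'Z(G)|).-1 * (2 * #|'Z(G)|) ^ (#|'Z(G)|.-1 * (#|H| %/ #|'Z(G)|))).
Proof.
move=> sHG abH iH nabG.
have sizesE := centralizer_sizes_index2 sHG abH iH nabG.
rewrite (kappaE (abelian_centralizer_index2 sHG abH iH nabG) nabG).
rewrite (perm_size sizesE) /= size_nseq (perm_big _ sizesE) /= big_cons.
rewrite big_nseq_muln -(Lagrange sHG) iH subnKC; last first.
  exact/subset_leq_card/center_sub_index2.
by rewrite addnn -mul2n [#|H| * 2]mulnC expnM.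
Qed.

(** * A common setting for the dihedral, semidihedral and quaternion relations *)

Section Metacyclic.

Variables (gT : finGroupType) (G : {group gT}) (x y : gT) (N d : nat).
Hypothesis N_gt2 : 2 < N.
Hypothesis defG : <[x]> <*> <[y]> = G.
Hypotheses (xN : (x ^+ N = 1)%g) (y2 : (y ^+ 2)%g \in <[x]>).
Hypothesis xy : (y * x * y^-1 = x^-1 * x ^+ d)%g.
Hypothesis oG : 2 * N <= #|G|.

Let Gx : x \in G. Proof. by rewrite -defG mem_gen // inE cycle_id. Qed.
Let Gy : y \in G. Proof. by rewrite -defG mem_gen // inE cycle_id orbT. Qed.
Let sHG : <[x]> \subset G. Proof. by rewrite cycle_subG. Qed.

(** The relations bound the order by [N] and the index by 2, and [2 * N <= #|G|] forces both
    equalities. *)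
Lemma metacyclic_index : #|<[x]>| = N /\ #|G : <[x]>| = 2.
Proof.
have nH : <[y]> \subset 'N(<[x]>).
  rewrite -[<[y]>]cycleV cycle_subG; apply/normP; apply/eqP.
  rewrite eqEcard cardJg leqnn andbT -cycleJ cycle_subG.
  by rewrite /conjg invgK mulgA xy groupM ?groupV ?mem_cycle ?cycle_id.
have leH : #|<[x]>| <= N by apply: dvdn_leq; [lia | rewrite order_dvdn xN].
have leI : #|G : <[x]>| <= 2.
  have nHy : y \in 'N(<[x]>) by rewrite -cycle_subG.
  have nHG : G \subset 'N(<[x]>) by rewrite -defG join_subG normG nH.
  rewrite -card_quotient // -[X in X / _]defG quotientYidl // quotient_cycle //.
  by apply: dvdn_leq => //; rewrite order_dvdn -morphX //= coset_id.
move: oG (Lagrange sHG) leH leI; move: #|<[x]>| #|G : <[x]>| #|G| => a [|[|[|]]] //; lia.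
Qed.

Let Hx : #|<[x]>| = N. Proof. by case: metacyclic_index. Qed.
Let iH : #|G : <[x]>| = 2. Proof. by case: metacyclic_index. Qed.

(** Together these two hypotheses make [h ^+ 2 = h ^+ d] equivalent to [h ^+ 2 = 1] when
    [h ^+ N = 1]. The exponent [d] is 0 in the dihedral and quaternion cases and [2 ^ (k - 2)] in
    the semidihedral one. *)
Hypothesis even_d : ~~ odd d.
Hypothesis d_sq : forall h : gT, (h ^+ N = 1 -> h ^+ 2 = h ^+ d -> h ^+ 2 = 1)%g.

(** Conjugation by [y] sends [h] to [h^-1 * h ^+ d], so commuting with [y] means
    [h ^+ 2 = h ^+ d]. *)
Lemma metacyclic_commute h : h \in <[x]> -> (h * y == y * h)%g = (h ^+ 2 == 1)%g.
Proof.
move=> Hh.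
have hy : (y * h * y^-1 = h^-1 * h ^+ d)%g.
  have /cycleP[i ->] := Hh.
  have cE z : (y * z * y^-1 = z ^ y^-1)%g by rewrite conjgE invgK mulgA.
  rewrite cE conjXg -cE xy expgMn; last by apply: commuteX; apply/commute_sym/commuteV.
  by rewrite expgVn -!expgM mulnC.
have hN : (h ^+ N = 1)%g by apply/eqP; rewrite -order_dvdn -Hx order_dvdG.
have -> : (h * y == y * h)%g = (h ^+ 2 == h ^+ d)%g.
  rewrite -(inj_eq (mulIg y^-1)) mulgK hy -(inj_eq (mulgI h)) mulKVg.
  by rewrite expgS expg1.
apply/eqP/eqP=> [|h2]; first exact: d_sq.
by rewrite -(odd_double_half d) (negPf even_d) add0n -mul2n expgM h2 expg1n.
Qed.

Lemma metacyclic_nonabelian : ~~ abelian G.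
Proof.
apply/negP=> /centsP/(_ x Gx y Gy)/eqP.
rewrite metacyclic_commute ?cycle_id // -order_dvdn orderE Hx => /dvdn_leq.
by lia.
Qed.

(** The center lies in [<[x]>], and an element of [<[x]>] is central as soon as it commutes with
    [y]. *)
Lemma metacyclic_center : 'Z(G) = [set h in <[x]> | h ^+ 2 == 1%g].
Proof.
have sZH := center_sub_index2 sHG (cycle_abelian x) iH metacyclic_nonabelian.
apply/setP=> h; rewrite [RHS]inE; apply/idP/andP => [hZ | [Hh h2]].
  have Hh := subsetP sZH h hZ; have /centerP[_ cGh] := hZ.
  by rewrite -metacyclic_commute // cGh.
have Gh := subsetP sHG h Hh; apply: centralizer_eqG => //.
have HC : <[x]> \subset 'C_G[h] by apply: (@index2_sub_centralizer _ _ <[x]>%G) => //; apply: cycle_abelian.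
have yC : y \in 'C_G[h] by rewrite mem_centralizer // metacyclic_commute.
by apply/eqP; rewrite eqEsubset subsetIl -{1}defG join_subG HC cycle_subG.
Qed.

Lemma card_metacyclic_center : #|'Z(G)| = if odd N then 1 else 2.
Proof.
rewrite metacyclic_center; case: ifP => oddN.
  rewrite -[RHS](cards1 (1%g : gT)); apply: eq_card => h; rewrite !inE.
  apply/andP/eqP => [[Hh] | ->]; last by rewrite group1 expg1n.
  rewrite -!order_dvdn => h2; apply/eqP; rewrite -order_eq1 -dvdn1.
  have : #[h] %| gcdn 2 N by rewrite dvdn_gcd h2 -Hx order_dvdG.
  by have /eqP -> : coprime 2 N by rewrite coprime2n.
have xn1 : (x ^+ N./2 != 1)%g.
  rewrite -order_dvdn orderE Hx; apply/negP=> /dvdn_leq; lia.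
(* Replacing [true] by the inequality [xn1] lets [cards2] read 2 as the cardinality of the pair of
   [1] and [x ^+ N./2]. *)
rewrite -[RHS]/(true.+1) -{1}xn1 eq_sym -cards2; apply: eq_card => h; rewrite !inE.
apply/andP/orP => [[/cyclePmin[i] +->] | [/eqP->|/eqP->]].
- rewrite orderE Hx -expgM -order_dvdn orderE Hx => ltiN /dvdnP[q iq].
  have [->|->] : i = 0 \/ i = N./2.
    case: q iq => [|[|q]] iq; first by left; lia.
      by right; rewrite -[N]mul1n -iq muln2 doubleK.
    by exfalso; nia.
    by rewrite expg0 eqxx; left.
  by right.
- by rewrite group1 expg1n.
by rewrite mem_cycle -expgM muln2 even_halfK ?oddN // xN.
Qed.

End Metacyclic.

(** * The presented groups *)

Section Model.

Import GRing.Theory.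
Local Open Scope ring_scope.

(* The pair [(a, s)] stands for [x ^ a * y ^ s] in the group of order [2 N] where
   [y * x * y^-1 = x ^ e] and [y ^ 2 = x ^ c]; it bounds the order of a presented
   group from below. *)
Definition twisted (N : nat) (e c : 'Z_N) (_ : e * e = 1) (_ : e * c = c) : Type :=
  ('Z_N * bool)%type.

Variables (N : nat) (e c : 'Z_N) (ee : e * e = 1) (ec : e * c = c).
Local Notation T := (twisted ee ec).

HB.instance Definition _ := Finite.copy T ('Z_N * bool)%type.

Implicit Types u v w : T.

(** Moving [y] past [x ^ b] turns [b] into [e * b], and two factors [y] combine into [x ^ c]. *)
Definition tw_mul u v : T :=
  (u.1 + (if u.2 then e * v.1 else v.1) + (if u.2 && v.2 then c else 0), u.2 (+) v.2).
Definition tw_one : T := (0, false).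
Definition tw_inv u : T := if u.2 then (- (e * u.1) - c, true) else (- u.1, false).

(** Here [e * e = 1] says that [y ^ 2] commutes with [x], and [e * c = c] that [y] commutes with
    [y ^ 2]. *)
Lemma tw_mulA : associative tw_mul.
Proof.
by move=> [a [|]] [b [|]] [d [|]]; rewrite /tw_mul /=; congr (_, _);
  rewrite ?mulrDr ?ec ?mulrA ?ee; ring.
Qed.

Lemma tw_mul1 : left_id tw_one tw_mul.
Proof. by move=> [a s]; rewrite /tw_mul /= add0r addr0. Qed.

Lemma tw_mulV : left_inverse tw_one tw_inv tw_mul.
Proof.
by move=> [a [|]]; rewrite /tw_mul /tw_inv /tw_one /=; congr (_, _); ring.
Qed.

HB.instance Definition _ := Finite_isGroup.Build T tw_mulA tw_mul1 tw_mulV.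

Definition tw_x : T := (1, false).
Definition tw_y : T := (0, true).

Lemma tw_mulE u v : (u * v)%g = tw_mul u v. Proof. by []. Qed.

Lemma tw_xX n : (tw_x ^+ n)%g = (n%:R, false) :> T.
Proof.
elim: n => [|n IHn] //; rewrite expgS IHn tw_mulE /tw_mul /= addr0.
by rewrite -natr1 addrC.
Qed.

Lemma tw_y2 : (tw_y ^+ 2)%g = (c, false) :> T.
Proof. by rewrite expgS expg1 tw_mulE /tw_mul /= mulr0 !add0r. Qed.

Lemma tw_xV : (tw_x^-1)%g = (-1, false) :> T.
Proof. by []. Qed.

Lemma tw_conj : (tw_y * tw_x * tw_y^-1)%g = (e, false) :> T.
Proof.
rewrite [(tw_y^-1)%g]/(tw_inv tw_y) !tw_mulE /tw_mul /tw_inv /=; congr (_, _).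
by rewrite mulr1 mulr0 oppr0 !add0r addr0 mulrN ec subrK.
Qed.

Lemma tw_gen : (<[tw_x]> <*> <[tw_y]>)%g = [set: T].
Proof.
apply/eqP; rewrite eqEsubset subsetT /=; apply/subsetP=> -[a s] _.
have -> : (a, s) = (tw_x ^+ a * tw_y ^+ s)%g :> T.
  rewrite tw_xX natr_Zp tw_mulE; case: s; rewrite /tw_mul /= ?addr0 //.
by rewrite groupM // groupX // mem_gen // inE cycle_id ?orbT.
Qed.

Lemma card_twisted : (1 < N)%N -> #|[set: T]| = (2 * N)%N.
Proof.
by move=> N1; rewrite cardsT -[T]/('Z_N * bool)%type card_prod card_bool card_ord Zp_cast // mulnC.
Qed.

End Model.

(** * Lower bounds on the orders of the presented groups *)

Section PresentationOrders.

Import GRing.Theory.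


(** The model with [e = -1] and [c = 0] satisfies the relations, hence is an image of [G]. *)
Lemma card_ge_dihedral (gT : finGroupType) (G : {group gT}) k :
  1 < k -> is_dihedral G k -> 2 * k <= #|G|.
Proof.
move=> k_gt1 isoG.
have ee : (-1 * -1 = 1 :> 'Z_k)%R by ring.
have ec : (-1 * 0 = 0 :> 'Z_k)%R by ring.
rewrite -(card_twisted ee ec) //; apply: leq_homg; rewrite isoG.
apply/existsP; exists (tw_x ee ec, tw_y ee ec).
by rewrite /= tw_gen tw_xX tw_y2 tw_conj tw_xV pchar_Zp // eqxx.
Qed.

Lemma card_ge_quaternion (gT : finGroupType) (G : {group gT}) k :
  0 < k -> is_quaternion G k -> 2 * (2 * k) <= #|G|.
Proof.
move=> k_gt0 isoG; have N_gt1 : 1 < 2 * k by lia.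
have ee : (-1 * -1 = 1 :> 'Z_(2 * k))%R by ring.
(* Here [c = k], and [-k = k] modulo [2 k]. *)
have ec : (-1 * k%:R = k%:R :> 'Z_(2 * k))%R.
  by rewrite mulN1r; apply: addr0_eq; rewrite -natrD addnn -mul2n pchar_Zp.
rewrite -(card_twisted ee ec) //; apply: leq_homg; rewrite isoG.
apply/existsP; exists (tw_x ee ec, tw_y ee ec).
by rewrite /= tw_gen !tw_xX tw_y2 tw_conj tw_xV pchar_Zp // eqxx.
Qed.

Lemma card_ge_semidihedral (gT : finGroupType) (G : {group gT}) k :
  3 <= k -> is_semidihedral G k -> 2 * 2 ^ (k - 1) <= #|G|.
Proof.
move=> k_gt2 isoG; have N_gt1 : 1 < 2 ^ (k - 1) by rewrite -{1}(expn0 2) ltn_exp2l; lia.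
pose e : 'Z_(2 ^ (k - 1)) := (-1 + (2 ^ (k - 2))%:R)%R.
have ee : (e * e = 1)%R.
  have N0 := pchar_Zp N_gt1.
  (* The last term of the square is [2 ^ (2 k - 4)], a multiple of [2 ^ (k - 1)] because
     [k >= 3]. *)
  have -> : (e * e = 1 - (2 ^ (k - 1))%:R + (2 ^ (k - 1))%:R * (2 ^ (k - 3))%:R)%R.
    rewrite -natrM -expnD /e.
    have -> : k - 1 + (k - 3) = (k - 2) + (k - 2) by lia.
    have -> : k - 1 = (k - 2).+1 by lia.
    by rewrite expnS expnD; ring.
  by rewrite N0; ring.
have ec : (e * 0 = 0)%R by ring.
rewrite -(card_twisted ee ec) //; apply: leq_homg; rewrite isoG.
apply/existsP; exists (tw_x ee ec, tw_y ee ec).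
by rewrite /= tw_gen !tw_xX tw_y2 tw_conj tw_xV tw_mulE /tw_mul /= addr0 pchar_Zp // eqxx.
Qed.

End PresentationOrders.

(** * Invariants of the three presented families *)

Lemma commuting_graph_metacyclic (gT : finGroupType) (G : {group gT}) (x y : gT)
    (N d m : nat) :
    2 < N -> ~~ odd d ->
    (forall h : gT, h ^+ N = 1 -> h ^+ 2 = h ^+ d -> h ^+ 2 = 1)%g ->
    <[x]> <*> <[y]> = G -> (x ^+ N = 1)%g -> (y ^+ 2)%g \in <[x]> ->
    (y * x * y^-1 = x^-1 * x ^+ d)%g -> 2 * N <= #|G| ->
    m = (if odd N then 1 else 2) ->
  [/\ #|G| = 2 * N, #|'Z(G)| = m, #|noncentral_centralizers G| = N %/ m + 1,
      perm_eq (centralizer_sizes G) ((N - m) :: nseq (N %/ m) m)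
    & kappa G = (2 * N) ^ m.-1 * m ^ (N %/ m) *
                (N ^ (N - m).-1 * (2 * m) ^ (m.-1 * (N %/ m)))].
Proof.
move=> N_gt2 even_d d_sq defG xN y2 xy oG mE.
have [oH iH] := metacyclic_index N_gt2 defG xN y2 xy oG.
have nabG := metacyclic_nonabelian N_gt2 defG xN y2 xy oG even_d d_sq.
have oZ := card_metacyclic_center N_gt2 defG xN y2 xy oG even_d d_sq.
have sHG : <[x]> \subset G by rewrite -defG joing_subl.
have sizesE := centralizer_sizes_index2 sHG (cycle_abelian x) iH nabG.
have kE := kappa_index2 sHG (cycle_abelian x) iH nabG.
rewrite /= oH oZ -mE in sizesE kE; split=> //.
- by rewrite -(Lagrange sHG) /= oH iH mulnC.
- by rewrite oZ.
by rewrite card_noncentral_centralizers (perm_size sizesE) /= size_nseq addn1.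
Qed.

Lemma dihedral_structure (gT : finGroupType) (G : {group gT}) k m :
    2 < k -> is_dihedral G k -> m = (if odd k then 1 else 2) ->
  [/\ #|G| = 2 * k, #|'Z(G)| = m, #|noncentral_centralizers G| = k %/ m + 1,
      perm_eq (centralizer_sizes G) ((k - m) :: nseq (k %/ m) m)
    & kappa G = (2 * k) ^ m.-1 * m ^ (k %/ m) *
                (k ^ (k - m).-1 * (2 * m) ^ (m.-1 * (k %/ m)))].
Proof.
move=> k_gt2 isoG mE; have oG := card_ge_dihedral (ltnW k_gt2) isoG.
case/existsP: (isoGrp_hom isoG) => -[x y] /= /eqP[defG xk y2 xy].
apply: (@commuting_graph_metacyclic _ G x y k 0) => //; first by rewrite y2 group1.
by rewrite xy expg0 mulg1.
Qed.

Lemma quaternion_structure (gT : finGroupType) (G : {group gT}) k :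
    1 < k -> is_quaternion G k ->
  [/\ #|G| = 2 * (2 * k), #|'Z(G)| = 2, #|noncentral_centralizers G| = 2 * k %/ 2 + 1,
      perm_eq (centralizer_sizes G) ((2 * k - 2) :: nseq (2 * k %/ 2) 2)
    & kappa G = (2 * (2 * k)) ^ 1 * 2 ^ (2 * k %/ 2) *
                ((2 * k) ^ (2 * k - 2).-1 * (2 * 2) ^ (1 * (2 * k %/ 2)))].
Proof.
move=> k_gt1 isoG; have oG := card_ge_quaternion (ltnW k_gt1) isoG.
case/existsP: (isoGrp_hom isoG) => -[x y] /= /eqP[defG xk y2 xy].
apply: (@commuting_graph_metacyclic _ G x y _ 0) => //.
- lia.
- by rewrite y2 mem_cycle.
- by rewrite xy expg0 mulg1.
by rewrite mul2n odd_double.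
Qed.

Lemma semidihedral_structure (gT : finGroupType) (G : {group gT}) k :
    3 < k -> is_semidihedral G k -> let N := 2 ^ (k - 1) in
  [/\ #|G| = 2 * N, #|'Z(G)| = 2, #|noncentral_centralizers G| = N %/ 2 + 1,
      perm_eq (centralizer_sizes G) ((N - 2) :: nseq (N %/ 2) 2)
    & kappa G = (2 * N) ^ 1 * 2 ^ (N %/ 2) *
                (N ^ (N - 2).-1 * (2 * 2) ^ (1 * (N %/ 2)))].
Proof.
move=> k_gt3 isoG N; have oG := card_ge_semidihedral (ltnW k_gt3) isoG.
case/existsP: (isoGrp_hom isoG) => -[x y] /= /eqP[defG xk y2 xy].
apply: (@commuting_graph_metacyclic _ G x y _ (2 ^ (k - 2))) => //.
- by apply: (@leq_trans (2 ^ 3)) => //; rewrite leq_exp2l //; lia.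
- by rewrite oddX; lia.
(* The order of [z = h ^+ 2] divides both [2 ^ (k - 2)] and [2 ^ (k - 3) - 1]; the latter is odd
   because [k > 3], so [z = 1]. *)
- rewrite /N => h hN h2d.
  have [j kj] : exists j, k = j.+4 by exists (k - 4); lia.
  have [NE dE] : k - 1 = j.+3 /\ k - 2 = j.+2 by lia.
  rewrite NE expnS expgM in hN; rewrite dE expnS expgM in h2d.
  set z := (h ^+ 2)%g in hN h2d *.
  have z1 : (z ^+ (2 ^ j.+1).-1 = 1)%g.
    apply: (mulgI z); rewrite mulg1 -expgS prednK ?expn_gt0 //.
  apply/eqP; rewrite -order_eq1 -dvdn1.
  have /eqP <- : coprime (2 ^ j.+2) (2 ^ j.+1).-1.
    rewrite coprimeXl // coprime2n -subn1 oddB ?expn_gt0 // oddX //.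
  by rewrite dvdn_gcd !order_dvdn hN z1 eqxx.
- by rewrite y2 group1.
by rewrite oddX; case: eqP => //; lia.
Qed.

(** * The closed forms in the five cases *)

Theorem mainTheorem9 :
  (forall (gT : finGroupType) (G : {group gT}) (k : nat),
    3 <= k -> odd k -> is_dihedral G k ->
    [/\ #|G| = 2 * k,
        #|'Z(G)%g| = 1,
        #|noncentral_centralizers G| = k + 1,
        perm_eq (centralizer_sizes G) ((k - 1) :: nseq k 1)
      & kappa G = k ^ (k - 2)])
  /\
  (forall (gT : finGroupType) (G : {group gT}) (k : nat),
    4 <= k -> ~~ odd k -> is_dihedral G k ->
    [/\ #|G| = 2 * k,
        #|'Z(G)%g| = 2,
        #|noncentral_centralizers G| = k %/ 2 + 1,
        perm_eq (centralizer_sizes G) ((k - 2) :: nseq (k %/ 2) 2)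
      & kappa G = 2 ^ ((3 * k + 2) %/ 2) * k ^ (k - 2)])
  /\
  (forall (gT : finGroupType) (G : {group gT}) (k : nat),
    2 <= k -> is_quaternion G k ->
    [/\ #|G| = 4 * k,
        #|'Z(G)%g| = 2,
        #|noncentral_centralizers G| = k + 1,
        perm_eq (centralizer_sizes G) ((2 * k - 2) :: nseq k 2)
      & kappa G = 2 ^ (5 * k - 1) * k ^ (2 * k - 2)])
  /\
  (forall (gT : finGroupType) (G : {group gT}) (k : nat),
    4 <= k -> is_semidihedral G k ->
    [/\ #|G| = 2 ^ k,
        #|'Z(G)%g| = 2,
        #|noncentral_centralizers G| = 2 ^ (k - 2) + 1,
        perm_eq (centralizer_sizes G)
                ((2 ^ (k - 1) - 2) :: nseq (2 ^ (k - 2)) 2)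
      & kappa G = 2 ^ ((2 ^ (k - 2) - 1) * (2 * k + 1) + 4)])
  /\
  (forall (gT : finGroupType) (G : {group gT}) (p : nat),
    prime p -> ~~ abelian G -> #|G| = p ^ 3 ->
    [/\ #|G| = p ^ 3,
        #|'Z(G)%g| = p,
        #|noncentral_centralizers G| = p + 1,
        perm_eq (centralizer_sizes G) (nseq (p + 1) (p ^ 2 - p))
      & kappa G = p ^ (2 * p ^ 3 - 5)]).
Proof.
split; [|split; [|split; [|split]]] => gT G k.
- move=> k_gt2 odd_k isoG; have := @dihedral_structure _ G k 1 k_gt2 isoG.
  rewrite odd_k divn1 => /(_ erefl)[-> -> -> sizesE ->]; split=> //.
  by rewrite exp1n mul0n !expn0 !mul1n muln1 -subn1 -subnDA.
- move=> k_gt3 even_k isoG; have := @dihedral_structure _ G k 2 (ltnW k_gt3) isoG.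
  rewrite (negPf even_k) => /(_ erefl)[-> -> -> sizesE ->]; split=> //.
  have [j kj] : exists j, k = (j.+2) * 2.
    exists (k./2 - 2); rewrite -[LHS](odd_double_half k) (negPf even_k) -muln2; lia.
  (* The summands are the exponents of 2 in [2 k], [2 ^ (k / 2)] and [4 ^ (k / 2)]. *)
  have -> : (3 * k + 2) %/ 2 = 1 + j.+2 + 2 * j.+2.
    rewrite kj; have -> : 3 * (j.+2 * 2) + 2 = (1 + j.+2 + 2 * j.+2) * 2 by lia.
    by rewrite mulnK.
  rewrite [in k %/ 2]kj mulnK // mul1n expn1 !expnD expn1.
  rewrite [2 ^ (2 * _)]expnM.
  have -> : k - 2 = (k - 2).-1.+1 by lia.
  by rewrite [k ^ _.+1]expnS -[2 * 2]/(2 ^ 2) /=; ring.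
- move=> k_gt1 isoG; have := quaternion_structure k_gt1 isoG.
  rewrite mulKn // => -[-> -> -> sizesE ->]; split=> //; first lia.
    have -> : 2 * k - 2 = (2 * k - 2).-1.+1 by lia.
  (* The summands are the exponents of 2 in [4 k], [2 ^ k], [(2 k) ^ (2 k - 3)] and [4 ^ k]. *)
  have -> : 5 * k - 1 = 2 + k + (2 * k - 2).-1 + 2 * k by lia.
  rewrite /= mul1n expn1 expnMn (expnD 2 _ (2 * k)) (expnD 2 _ (2 * k - 2).-1).
  by rewrite (expnD 2 2 k) (expnM 2 2 k) [k ^ _.+1]expnS -[2 * 2]/(2 ^ 2); ring.
- move=> k_gt3 isoG; have := semidihedral_structure k_gt3 isoG.
  have N2a : 2 ^ (k - 1) = 2 * 2 ^ (k - 2).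
    by have -> : k - 1 = (k - 2).+1; [lia | rewrite expnS].
  have N2 : 2 ^ (k - 1) %/ 2 = 2 ^ (k - 2) by rewrite N2a mulKn.
  rewrite /= N2 => -[-> -> -> sizesE ->]; split=> //.
    by rewrite -expnS; congr (_ ^ _); lia.
  have a_gt2 : 2 < 2 ^ (k - 2) by rewrite -{1}(expn1 2) ltn_exp2l //; lia.
  rewrite (_ : 2 * 2 = 2 ^ 2) // -expnS -!expnM -!expnD; congr (_ ^ _).
  (* With [a = 2 ^ (k - 2)] the exponent is [k + a + (k - 1) (2 a - 3) + 2 a]; the substitutions for
     [a] and [k] below remove the truncated subtractions. *)
  rewrite N2a; move: {N2 sizesE N2a} (2 ^ (k - 2)) a_gt2 => a a_gt2.
  have [b ->] : exists b, a = b.+3 by exists (a - 3); lia.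
  have [j ->] : exists j, k = j.+1 by exists (k - 1); lia.
  nia.
move=> pr_p nabG oG; split=> //.
- exact: card_center_pcube.
- by rewrite card_noncentral_centralizers (centralizer_sizes_pcube pr_p nabG oG) size_nseq.
- by rewrite (centralizer_sizes_pcube pr_p nabG oG).
exact: kappa_pcube.
Qed.
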